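(* Let $G$ be a groupoid on a topological space $X$, let $H\in L_G(X)$ be a wide subgroupoid of $G$, and let $s$ be the local subgroupoid $s=loc(H)$ of $G$. Let $\mathcal{V}$ be an open cover of $X$ and let $H_{\mathcal{V}}$ be the subgroupoid of $G$ generated by the subgroupoids $H|V$, $V\in\mathcal{V}$. Then the transitivity components of $H_{\mathcal{V}}$ are relatively closed and open in the transitivity components of $H$; that is, for each $x\in X$, the transitivity component of $x$ in $H_{\mathcal{V}}$ is an open and closed subset of the transitivity component of $x$ in $H$ (with the subspace topology from $X$).
   Context: $X$ is a topological space and $G$ is a groupoid on $X$, i.e. an (abstract) groupoid with object set $X$. For an open set $U\subseteq X$, $G|U$ is the full subgroupoid of $G$ on the objects in $U$, and $L_G(U)$ is the set of all wide subgroupoids of $G|U$ (subgroupoids having all points of $U$ as objects). For $V\subseteq U$ open and $H\in L_G(U)$, $H|V\in L_G(V)$ is the full subgroupoid of $H$ on $V$; this makes $L_G$ a presheaf on $X$. Let $\mathcal{L}_G\to X$ be the associated sheaf (space of germs). The germ at $x\in U$ of $H\in L_G(U)$ is written $(U,H)_x$; thus $(U,H)_x=(V,K)_x$ iff $H|W=K|W$ for some open $W$ with $x\in W\subseteq U\cap V$. A local subgroupoid of $G$ is a global section $s:X\to\mathcal{L}_G$. For a wide subgroupoid $H$ of $G$, $loc(H)$ is the local subgroupoid $x\mapsto (X,H)_x$. The transitivity component of $x$ in a groupoid $K$ on $X$ is the set of all $y\in X$ such that $K(x,y)$, the set of morphisms of $K$ from $x$ to $y$, is non-empty. *)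

(* Defs.v *)
From HB Require Import structures.
From mathcomp Require Import all_boot all_classical.
From mathcomp Require Import topology.

Set Implicit Arguments.
Unset Strict Implicit.
Unset Printing Implicit Defensive.

Local Open Scope classical_set_scope.

(* Composition is written in diagrammatic order. *)
Record groupoid (X : Type) := Groupoid {
  hom :> X -> X -> Type;
  gid : forall x, hom x x;
  gcomp : forall x y z, hom x y -> hom y z -> hom x z;
  ginv : forall x y, hom x y -> hom y x;
  gcompA : forall x y z t (a : hom x y) (b : hom y z) (c : hom z t),
    gcomp a (gcomp b c) = gcomp (gcomp a b) c;
  gcomp1g : forall x y (a : hom x y), gcomp (gid x) a = a;
  gcompg1 : forall x y (a : hom x y), gcomp a (gid y) = a;
  gcompgV : forall x y (a : hom x y), gcomp a (ginv a) = gid x;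
  gcompVg : forall x y (a : hom x y), gcomp (ginv a) a = gid y
}.

Arguments gid {X} g x.

Record subgroupoid (X : Type) (G : groupoid X) := Subgroupoid {
  sobj : set X;
  shom : forall x y, set (G x y);
  shom_obj : forall x y (a : G x y), shom a -> sobj x /\ sobj y;
  shom_id : forall x, sobj x -> shom (gid G x);
  shom_comp : forall x y z (a : G x y) (b : G y z),
    shom a -> shom b -> shom (gcomp a b);
  shom_inv : forall x y (a : G x y), shom a -> shom (ginv a)
}.

Arguments shom {X G} s x y _.

#[local] Obligation Tactic := idtac.

Section Subgroupoids.
Variables (X : Type) (G : groupoid X).
Implicit Types (H K : subgroupoid G) (U V W : set X).

Definition sub_subgroupoid K H :=
  sobj K `<=` sobj H /\ forall x y, shom K x y `<=` shom H x y.

Program Definition whole : subgroupoid G :=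
  @Subgroupoid X G setT (fun _ _ => setT) _ _ _ _.
Solve Obligations with by [].

(* The full subgroupoid H|V of H on the objects lying in V. *)
Program Definition full H V : subgroupoid G :=
  @Subgroupoid X G (sobj H `&` V)
    (fun x y => [set a | [/\ V x, V y & shom H x y a]]) _ _ _ _.
Next Obligation. by move=> H V x y a [Vx Vy Ha]; have [] := shom_obj Ha. Qed.
Next Obligation. by move=> H V x [? ?]; split=> //; exact: shom_id. Qed.
Next Obligation.
by move=> H V x y z a b [? _ ?] [_ ? ?]; split=> //; exact: shom_comp.
Qed.
Next Obligation. by move=> H V x y a [? ? ?]; split=> //; exact: shom_inv. Qed.

Definition wide_in K H := sub_subgroupoid K H /\ sobj K = sobj H.

(* L_G(U): the wide subgroupoids of G|U. *)
Definition L_G U : set (subgroupoid G) := [set K | wide_in K (full whole U)].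

(* The subgroupoid generated by a family of subgroupoids: the intersection of
   all subgroupoids of G containing every member of the family. *)
Program Definition generated (F : set (subgroupoid G)) : subgroupoid G :=
  let upper := [set K | forall L, F L -> sub_subgroupoid L K] in
  @Subgroupoid X G (\bigcap_(K in upper) sobj K)
    (fun x y => \bigcap_(K in upper) shom K x y) _ _ _ _.
Next Obligation.
by move=> F upper x y a aF; split=> K /aF Ka; have [] := shom_obj Ka.
Qed.
Next Obligation. by move=> F upper x xF K /xF; exact: shom_id. Qed.
Next Obligation.
move=> F upper x y z a b aF bF K uK.
by apply: shom_comp; [exact: aF|exact: bF].
Qed.
Next Obligation. by move=> F upper x y a aF K /aF; exact: shom_inv. Qed.

Definition component K (x : X) : set X := [set y | shom K x y !=set0].

Lemma subgroupoid_eq H K : sobj H = sobj K ->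
  (forall x y, shom H x y = shom K x y) -> H = K.
Proof.
case: H => o h p1 p2 p3 p4; case: K => o' h' q1 q2 q3 q4 /= oo' hh'.
have {}hh' : h = h'.
  by apply: functional_extensionality_dep => x;
     apply: functional_extensionality_dep => y; exact: hh'.
move: p1 p2 p3 p4 q1 q2 q3 q4; rewrite oo' hh' => *.
by congr Subgroupoid; exact: Prop_irrelevance.
Qed.

Lemma full_full H U V : full (full H U) V = full H (U `&` V).
Proof.
apply: subgroupoid_eq => [|x y]; first by rewrite /= setIA.
by apply/seteqP; split => [a [? ? [? ? ?]]|a [[? ?] [? ?] ?]].
Qed.

Lemma full_sub H K V W : W `<=` V ->
  full H V = full K V -> full H W = full K W.
Proof. by move=> /setIidr <- e; rewrite -2!full_full e. Qed.

Lemma full_L_G U V H : V `<=` U -> L_G U H -> L_G V (full H V).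
Proof.
move=> VU [_ /= oH]; split; last first.
  by rewrite /= oH; apply/seteqP; split=> x /=; [case=> -[]|move=> [_ /[dup] /VU]].
by split=> [x [_ ?]|x y a [? ? _]].
Qed.

End Subgroupoids.

Arguments whole {X} G.
Arguments L_G {X} G U.

Section Germs.
Variables (X : topologicalType) (G : groupoid X).
Implicit Types (p q : set X * subgroupoid G).

Definition local_rep (x : X) : set (set X * subgroupoid G) :=
  [set p | [/\ open p.1, p.1 x & L_G G p.1 p.2]].

Definition germ_rel (x : X) p q := exists W : set X,
  [/\ open W, W x, W `<=` p.1 `&` q.1 & full p.2 W = full q.2 W].

Definition germ_class (x : X) p : set (set X * subgroupoid G) :=
  [set q | local_rep x q /\ germ_rel x p q].

(* The total space of the sheaf: a germ at x is an equivalence class of pairs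
   (U, H) with U an open neighbourhood of x and H in L_G(U). *)
Record germ_space := GermSpace {
  germ_pt : X;
  germ_cls : set (set X * subgroupoid G);
  germ_clsP : exists2 p, local_rep germ_pt p & germ_cls = germ_class germ_pt p
}.

Lemma germ_subproof (U : set X) (H : subgroupoid G) (x : X) :
  open U -> L_G G U H -> U x ->
  exists2 p, local_rep x p & germ_class x (U, H) = germ_class x p.
Proof. by move=> oU HU Ux; exists (U, H). Qed.

(* The germ (U, H)_x. *)
Definition germ (U : set X) (H : subgroupoid G) (x : X)
    (oU : open U) (HU : L_G G U H) (Ux : U x) : germ_space :=
  GermSpace (germ_subproof oU HU Ux).

Lemma germ_rel_refl x p : local_rep x p -> germ_rel x p p.
Proof. by case: p => U H [/= ? ? ?]; exists U; split=> //= y. Qed.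

Lemma germ_rel_sym x p q : germ_rel x p q -> germ_rel x q p.
Proof. by move=> [W [? ? WU ?]]; exists W; split=> //; rewrite setIC. Qed.

Lemma germ_rel_trans x p q r :
  germ_rel x p q -> germ_rel x q r -> germ_rel x p r.
Proof.
move=> [W [oW Wx WU e]] [W' [oW' W'x WU' e']].
exists (W `&` W'); split=> //; first exact: openI.
  by move=> y [/WU[? _] /WU'[]].
rewrite (full_sub _ e); last by move=> y [].
by rewrite (full_sub _ e') // => y [].
Qed.

Lemma germ_class_eqP x p q : local_rep x p -> local_rep x q ->
  germ_class x p = germ_class x q <-> germ_rel x p q.
Proof.
move=> px qx; split=> [e|pq].
  have : germ_class x q q by split=> //; exact: germ_rel_refl.
  by rewrite -e => -[].
apply/seteqP; split=> r [rx r1]; split=> //.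
  exact: germ_rel_trans (germ_rel_sym pq) r1.
exact: germ_rel_trans r1.
Qed.

Lemma germ_space_eq (g g' : germ_space) :
  germ_pt g = germ_pt g' -> germ_cls g = germ_cls g' -> g = g'.
Proof.
case: g => x c P; case: g' => x' c' P' /= xx' cc'.
by move: P P'; rewrite xx' cc' => P P'; rewrite (Prop_irrelevance P P').
Qed.

Lemma germ_eqP (U V : set X) (H K : subgroupoid G) (x : X)
    (oU : open U) (oV : open V) (HU : L_G G U H) (KV : L_G G V K)
    (Ux : U x) (Vx : V x) :
  germ oU HU Ux = germ oV KV Vx <-> exists W : set X,
    [/\ open W, W x, W `<=` U `&` V & full H W = full K W].
Proof.
have Up : local_rep x (U, H) by [].
have Vp : local_rep x (V, K) by [].
split=> [/(congr1 germ_cls) /= /(germ_class_eqP Up Vp) //|e].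
by apply: germ_space_eq => //=; exact/(germ_class_eqP Up Vp).
Qed.

(* The sheaf topology has as basis the sets {(U, H)_x | x in U}. *)
Definition germ_basic (U : set X) (oU : open U) (H : subgroupoid G)
    (HU : L_G G U H) : set germ_space :=
  [set g | exists (x : X) (Ux : U x), g = germ oU HU Ux].

Definition germ_open (O : set germ_space) := forall g, O g ->
  exists (U : set X) (oU : open U) (H : subgroupoid G) (HU : L_G G U H),
    germ_basic oU HU g /\ germ_basic oU HU `<=` O.

Lemma germ_openT : germ_open setT.
Proof.
move=> [x c [[U H] [/= oU Ux HU] e]] _; exists U, oU, H, HU; split=> //.
by exists x, Ux; exact: germ_space_eq.
Qed.

Lemma germ_openI (A B : set germ_space) :
  germ_open A -> germ_open B -> germ_open (A `&` B).
Proof.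
move=> oA oB g [/oA[U [oU [H [HU [[x [Ux ->]] UA]]]]]].
move=> /oB[V [oV [K [KV [[y [Vy e]] VB]]]]].
move: (congr1 germ_pt e) => /= xy; move: Vy e; rewrite -{y}xy => Vx.
move=> /germ_eqP[W [oW Wx WUV HK]].
have WU : W `<=` U by move=> ? /WUV[].
have WV : W `<=` V by move=> ? /WUV[].
exists W, oW, (full H W), (full_L_G WU HU); split.
  exists x, Wx; apply/germ_eqP; exists W; split=> //; first by move=> ? ?; split=> //; exact: WU.
  by rewrite full_full setIid.
move=> _ [z [Wz ->]]; split.
  apply: UA; exists z, (WU _ Wz); apply/germ_eqP; exists W; split=> //.
    by move=> ? ?; split=> //; exact: WU.
  by rewrite full_full setIid.
apply: VB; exists z, (WV _ Wz); apply/germ_eqP; exists W; split=> //.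
  by move=> ? ?; split=> //; exact: WV.
by rewrite full_full setIid.
Qed.

Lemma germ_open_bigU (I : Type) (f : I -> set germ_space) :
  (forall i, germ_open (f i)) -> germ_open (\bigcup_i f i).
Proof.
move=> fo g [i _ /fo[U [oU [H [HU [gU Uf]]]]]].
by exists U, oU, H, HU; split=> // h /Uf; exists i.
Qed.

HB.instance Definition _ := gen_eqMixin germ_space.
HB.instance Definition _ := gen_choiceMixin germ_space.
HB.instance Definition _ :=
  isOpenTopological.Build germ_space germ_openT germ_openI germ_open_bigU.

(* A global section of the sheaf, i.e. a continuous right inverse of the
   projection germ_pt. *)
Record local_subgroupoid := LocalSubgroupoid {
  local_fun :> X -> germ_space;
  local_section : forall x, germ_pt (local_fun x) = x;
  local_continuous : continuous local_fun
}.

Definition loc_fun (H : subgroupoid G) (HX : L_G G setT H) (x : X) : germ_space :=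
  germ openT HX (I : [set: X] x).

Lemma loc_continuous (H : subgroupoid G) (HX : L_G G setT H) :
  continuous (loc_fun HX).
Proof.
apply/continuousP => A oA; rewrite openE => x /= /oA.
move=> [U [oU [K [KU [[y [Uy e]] UA]]]]].
move: (congr1 germ_pt e) => /= xy; move: Uy e; rewrite -{y}xy => Ux.
move=> /germ_eqP[W [oW Wx WU HK]].
rewrite /interior nbhsE; exists W => // z Wz; apply: UA.
by exists z, (WU _ Wz).2; apply/germ_eqP; exists W.
Qed.

Definition loc (H : subgroupoid G) (HX : L_G G setT H) : local_subgroupoid :=
  @LocalSubgroupoid (loc_fun HX) (fun=> erefl) (@loc_continuous H HX).

End Germs.

(* H_V: the subgroupoid of G generated by the H|V, for V in the cover. *)
Definition cover_subgroupoid (X : Type) (G : groupoid X) (H : subgroupoid G)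
    (VV : set (set X)) : subgroupoid G :=
  generated [set full H V | V in VV].

(* Main.v *)
Require Import Defs.
From mathcomp Require Import all_boot all_classical.
From mathcomp Require Import topology.

Local Open Scope classical_set_scope.

(** Membership in the component N of x in H_VV is locally constant on the
    component M of x in H, so N is clopen in M.  Indeed, let V be a member of
    the cover and let y, z be two points of M in V.  They are joined by a
    morphism of H, through x; having both ends in V, this morphism belongs to
    H|V, hence to H_VV ([cover_subgroupoid_local]).  So y is in N if and only
    if z is.  The inclusion of N in M holds because H is one of the
    subgroupoids containing every H|V ([cover_subgroupoid_sub]). *)

Section Components.
Set Implicit Arguments.
Unset Strict Implicit.
Variables (X : Type) (G : groupoid X).
Implicit Types (H K : subgroupoid G) (x y z : X).

Lemma component_sym K x y : component K x y -> component K y x.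
Proof. by move=> [a Ka]; exists (ginv a); exact: shom_inv. Qed.

Lemma component_trans K x y z :
  component K x y -> component K y z -> component K x z.
Proof. by move=> [a Ka] [b Kb]; exists (gcomp a b); exact: shom_comp. Qed.

Lemma sub_component K H x :
  sub_subgroupoid K H -> component K x `<=` component H x.
Proof. by move=> [_ KH] y [a Ka]; exists a; exact: KH. Qed.

Lemma generated_ub (F : set (subgroupoid G)) K :
  F K -> sub_subgroupoid K (generated F).
Proof.
by move=> FK; split=> /= [x Kx|x y a Ka] L /(_ _ FK)[oKL KL];
  [exact: oKL | exact: KL].
Qed.

Lemma generated_min (F : set (subgroupoid G)) K :
  (forall L, F L -> sub_subgroupoid L K) -> sub_subgroupoid (generated F) K.
Proof. by move=> FK; split=> /= [x|x y a] /(_ _ FK). Qed.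

Lemma full_sub_subgroupoid H (V : set X) : sub_subgroupoid (full H V) H.
Proof. by split=> [x []|x y a []]. Qed.

Lemma cover_subgroupoid_sub H (VV : set (set X)) :
  sub_subgroupoid (cover_subgroupoid H VV) H.
Proof. by apply: generated_min => _ [V _ <-]; exact: full_sub_subgroupoid. Qed.

(** The generated subgroupoid loses no connectivity inside one member V of the
    cover, because H|V is full in H. *)
Lemma cover_subgroupoid_local H (VV : set (set X)) (V : set X) y z :
  VV V -> V y -> V z -> component H y z ->
  component (cover_subgroupoid H VV) y z.
Proof.
move=> VVV Vy Vz [a Ha].
apply: (@sub_component (full H V)); last by exists a.
by apply: generated_ub; exists V.
Qed.

End Components.

(** The hypothesis passes to the complement of P, so openness suffices. *)
Lemma locally_constant_clopen (T : topologicalType) (P : set T) :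
  (forall y, exists2 U : set T, open_nbhs y U & forall z, U z -> P y <-> P z) ->
  clopen P.
Proof.
move=> lcP; split; last rewrite -openC.
  rewrite openE => y Py; have [U Uy UP] := lcP y.
  by rewrite /interior nbhsE; exists U => // z /UP <-.
rewrite openE => y Py; have [U Uy UP] := lcP y.
by rewrite /interior nbhsE; exists U => // z /UP yz /yz.
Qed.

Theorem proposition2p8 (X : topologicalType) (G : groupoid X)
    (H : subgroupoid G) (HX : L_G G setT H)
    (s : local_subgroupoid G) (sH : s = loc HX)
    (VV : set (set X)) (VVopen : forall V, VV V -> open V)
    (VVcover : cover VV id = setT) (x : X) :
  let M := component H x in
  let N := component (cover_subgroupoid H VV) x in
  [/\ N `<=` M,
      open (set_val @^-1` N : set M) &
      closed (set_val @^-1` N : set M)].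
Proof.
move=> M N.
suff [oN cN] : clopen (set_val @^-1` N : set M).
  by split=> //; exact/sub_component/cover_subgroupoid_sub.
apply: locally_constant_clopen => y.
have [V VVV Vy] : cover VV id (set_val y) by rewrite VVcover.
exists (set_val @^-1` V).
  split=> //; apply: open_comp (VVopen _ VVV) => z _.
  exact: initial_continuous.
move=> z Vz.
have Hyz : component H (set_val y) (set_val z).
  by apply: component_trans (set_valP z); exact: component_sym (set_valP y).
have Nyz : component (cover_subgroupoid H VV) (set_val y) (set_val z).
  exact: cover_subgroupoid_local VVV _ _ Hyz.
split=> [Ny|Nz]; first exact: component_trans Nyz.
exact: component_trans Nz (component_sym Nyz).
Qed.
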